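(* Let $0\le r_1<r_2\le+\infty$ and suppose that $f(z)=\sum_{j=-\infty}^{+\infty}a_jz^j$ is a Laurent series centered at zero with complex coefficients, convergent for $r_1<|z|<r_2$. If $r_1<r<r_2$, then $$\sum_{j=-\infty}^{+\infty}|a_j|^2r^{2j}\le M(r)^2,\quad\text{where } M(r)=\max_{|z|=r}|f(z)|.$$
   Context: The Laurent series means the following: the power series $\sum_{n=0}^{+\infty}a_nz^n$ converges for $|z|<r_2$, the series $\sum_{m=1}^{+\infty}a_{-m}z^{-m}$ converges for $|z|>r_1$, and $f(z)=\sum_{m=1}^{+\infty}a_{-m}z^{-m}+\sum_{n=0}^{+\infty}a_nz^n$ for $r_1<|z|<r_2$. *)

(* Defs.v *)
From Stdlib Require Import Reals ZArith.
From Coquelicot Require Import Coquelicot.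

Open Scope R_scope.

(* The integer power [z ^ k] in [C]; same clauses as [powerRZ] on [R]. *)
Definition Cpowz (z : C) (k : Z) : C :=
  match k with
  | Z0 => RtoC 1
  | Zpos p => Cpow z (Pos.to_nat p)
  | Zneg p => Cinv (Cpow z (Pos.to_nat p))
  end.

(* In a series indexed by [Z], the negative half starts at index [-1], hence
   the shift by [S]. *)
Definition nonneg_part {T : Type} (u : Z -> T) (n : nat) : T := u (Z.of_nat n).
Definition neg_part {T : Type} (u : Z -> T) (n : nat) : T :=
  u (- Z.of_nat (S n))%Z.

(* The two halves are required to converge separately; this is stronger than
   convergence of the symmetric partial sums. *)
Definition is_series_Z {K : AbsRing} {V : NormedModule K}
    (u : Z -> V) (l : V) : Prop :=
  exists p q : V,
    is_series (neg_part u) p /\ is_series (nonneg_part u) q /\ l = plus p q.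

Definition laurent_term (a : Z -> C) (z : C) (j : Z) : C_NormedModule :=
  Cmult (a j) (Cpowz z j).

(* [f] is constrained only on the annulus. *)
Definition is_laurent_series (a : Z -> C) (r1 : R) (r2 : Rbar) (f : C -> C)
    : Prop :=
  (forall z : C, Rbar_lt (Cmod z) r2 ->
     ex_series (nonneg_part (laurent_term a z))) /\
  (forall z : C, r1 < Cmod z -> ex_series (neg_part (laurent_term a z))) /\
  (forall z : C, r1 < Cmod z -> Rbar_lt (Cmod z) r2 ->
     is_series_Z (laurent_term a z) (f z : C_NormedModule)).

Definition is_max_modulus (f : C -> C) (r M : R) : Prop :=
  (exists z : C, Cmod z = r /\ Cmod (f z) = M) /\
  (forall z : C, Cmod z = r -> Cmod (f z) <= M).

(* Main.v *)
Require Import Defs.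
From Stdlib Require Import Reals ZArith Lra Lia.
From Coquelicot Require Import Coquelicot.

(** Put [h w = |f (r w)|] for [|w| = 1].  Both halves of the Laurent series
    converge beyond the circle [|z| = r], on [|z| = rho] with [rho > r] for the
    nonnegative half and on a smaller circle for the negative half, so
    [|a_j| r^j] decays geometrically as [j] goes to either infinity
    ([laurent_weight_geometric]).  Hence the partial sums over the window
    [-(N+1) <= j <= N] converge to [f] uniformly on [|z| = r].  Multiplying such
    a partial sum by [w^(N+1)], which has modulus 1, turns it into a polynomial
    [Q_N] in [w] with coefficients [a_j r^j], so that [h] is the uniform limit
    of [|Q_N|] on the unit circle, with an error [e_N] that tends to 0
    ([laurent_approx]).

    The maximum [M] exists because a uniform limit of moduli of polynomials is
    continuous and the circle is the image of a segment under
    [t |-> (cos t, sin t)] ([uniform_limit_attains_max]).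

    For a polynomial of degree at most [n], averaging [|Q|^2] over the [n+1]-st
    roots of unity gives exactly the sum of the squared moduli of the
    coefficients ([discrete_parseval]); this finite form of Parseval's identity
    replaces the integral over the circle.  Applied to [Q_N], whose modulus is
    at most [M + e_N], it bounds the windowed sum of [|a_j|^2 r^(2j)] by
    [(M + e_N)^2], and [N] tends to infinity. *)

(** * The unit circle *)

Definition cis (t : R) : C := (cos t, sin t).

Lemma Cmod_cis (t : R) : Cmod (cis t) = 1.
Proof.
  unfold Cmod, cis; simpl fst; simpl snd.
  rewrite <- sqrt_1; f_equal.
  generalize (sin2_cos2 t); unfold Rsqr; lra.
Qed.

Lemma cis_pow (t : R) (n : nat) : Cpow (cis t) n = cis (INR n * t).
Proof.
  induction n as [|n IH].
  - unfold cis; simpl INR; rewrite Rmult_0_l, cos_0, sin_0; reflexivity.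
  - rewrite Cpow_S, IH, S_INR, Rmult_plus_distr_r, Rmult_1_l.
    unfold cis, Cmult; simpl fst; simpl snd.
    rewrite cos_plus, sin_plus; f_equal; ring.
Qed.

Lemma cis_neq_1 (t : R) : 0 < t < 2 * PI -> cis t <> RtoC 1.
Proof.
  intros Ht E; apply (f_equal fst) in E; simpl in E.
  replace t with (2 * (t / 2)) in E by field.
  rewrite cos_2a_sin in E.
  assert (0 < sin (t / 2)) by (apply sin_gt_0; lra).
  nra.
Qed.

(** The angle is [acos (Re w)] up to the sign of [Im w]; a compact range of
    angles is what lets the maximum be taken over a segment. *)
Lemma unit_circle_cis (w : C) :
  Cmod w = 1 -> exists t : R, - PI <= t <= PI /\ w = cis t.
Proof.
  intros Hw; pose proof (Cmod2_alt w) as E; rewrite Hw in E.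
  destruct w as [x y]; cbn [Re Im fst snd] in E.
  assert (Hx : -1 <= x <= 1) by nra.
  pose proof (acos_bound x) as Hb.
  assert (Hs : sin (acos x) = Rabs y).
  { rewrite sin_acos by exact Hx.
    rewrite <- sqrt_Rsqr_abs; apply (f_equal sqrt); unfold Rsqr; lra. }
  destruct (Rle_dec 0 y) as [Hy | Hy].
  - exists (acos x); split; [lra|]; unfold cis.
    rewrite cos_acos, Hs, Rabs_pos_eq by assumption; reflexivity.
  - exists (- acos x); split; [lra|]; unfold cis.
    rewrite cos_neg, sin_neg, cos_acos, Hs, Rabs_left by lra.
    f_equal; ring.
Qed.

Lemma cis_continuous (t eps : R) : 0 < eps ->
  exists del, 0 < del /\
    forall s, Rabs (s - t) < del -> Cmod (cis s - cis t) < eps.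
Proof.
  intros He.
  destruct (continuity_cos t (eps / 2)) as [d1 [Hd1 H1]]; [lra|].
  destruct (continuity_sin t (eps / 2)) as [d2 [Hd2 H2]]; [lra|].
  exists (Rmin d1 d2); split; [apply Rmin_pos; assumption|].
  intros s Hs.
  pose proof (Rmin_l d1 d2); pose proof (Rmin_r d1 d2).
  destruct (Req_dec t s) as [<- | Hne].
  { (* [limit1_in] only speaks of points different from [t]. *)
    replace (cis t - cis t)%C with (RtoC 0) by ring.
    rewrite Cmod_0; exact He. }
  assert (H1' : Rabs (cos s - cos t) < eps / 2)
    by (apply (H1 s); split; [split; [exact I | exact Hne] | simpl; unfold R_dist; lra]).
  assert (H2' : Rabs (sin s - sin t) < eps / 2)
    by (apply (H2 s); split; [split; [exact I | exact Hne] | simpl; unfold R_dist; lra]).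
  eapply Rle_lt_trans; [apply Cmod_2Rmax|].
  unfold cis, Cminus, Copp, Cplus; cbn [fst snd].
  assert (Hm : Rmax (Rabs (cos s + - cos t)) (Rabs (sin s + - sin t)) < eps / 2).
  { apply Rmax_lub_lt; assumption. }
  assert (sqrt 2 <= 2).
  { rewrite <- (sqrt_square 2) at 2 by lra; apply sqrt_le_1_alt; lra. }
  pose proof (Rmax_l (Rabs (cos s + - cos t)) (Rabs (sin s + - sin t))).
  pose proof (Rabs_pos (cos s + - cos t)).
  nra.
Qed.

(** * Polynomials on the unit circle *)

(** Sums in [C] have the carrier of some algebraic structure as their type, and
    [ring] recognises [C] only syntactically. *)
Ltac Cring :=
  match goal with |- @eq _ ?x ?y => change (@eq C x y) end;
  change (@mult C_Ring) with Cmult; change (@plus C_AbelianMonoid) with Cplus; ring.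

Definition peval (c : nat -> C) (d : nat) (w : C) : C :=
  sum_n (fun j => c j * Cpow w j)%C d.

Lemma sum_n_shift {G : AbelianMonoid} (u : nat -> G) (n : nat) :
  sum_n u (S n) = plus (u 0%nat) (sum_n (fun k => u (S k)) n).
Proof.
  induction n as [|n IH].
  - rewrite sum_Sn, !sum_O; reflexivity.
  - rewrite sum_Sn, IH, sum_Sn; symmetry; apply plus_assoc.
Qed.

(** Horner's rule.  Splitting off the constant coefficient, and not the leading
    one, is what keeps the conjugated powers out of [discrete_parseval]. *)
Lemma peval_S (c : nat -> C) (d : nat) (w : C) :
  peval c (S d) w = (c 0%nat + w * peval (fun j => c (S j)) d w)%C.
Proof.
  unfold peval; rewrite sum_n_shift.
  change (plus ?x ?y) with (x + y)%C; f_equal.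
  - simpl; ring.
  - rewrite <- (sum_n_mult_l (K := C_Ring)).
    apply sum_n_ext; intros k; rewrite Cpow_S; Cring.
Qed.

(** The bound [B] is there for the induction: the Lipschitz constant of
    [w * Q w] involves the size of [Q]. *)
Lemma peval_lipschitz (c : nat -> C) (d : nat) :
  exists B L : R, 0 <= B /\ 0 <= L /\
    forall w v : C, Cmod w = 1 -> Cmod v = 1 ->
      Cmod (peval c d w) <= B /\
      Cmod (peval c d w - peval c d v) <= L * Cmod (w - v).
Proof.
  revert c; induction d as [|d IH]; intros c.
  - exists (Cmod (c 0%nat)), 0; split; [apply Cmod_ge_0|split; [lra|]].
    intros w v _ _; unfold peval; rewrite !sum_O; simpl.
    split.
    + rewrite Cmult_1_r; lra.
    + match goal with |- Cmod ?x <= _ =>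
        replace x with (RtoC 0) by ring end.
      rewrite Cmod_0; lra.
  - destruct (IH (fun j => c (S j))) as (B & L & HB & HL & H).
    pose proof (Cmod_ge_0 (c 0%nat)).
    exists (Cmod (c 0%nat) + B), (B + L); split; [lra|split; [lra|]].
    intros w v Hw Hv; rewrite !peval_S.
    destruct (H w v Hw Hv) as [H1 H2].
    split.
    + eapply Rle_trans; [apply Cmod_triangle|].
      rewrite Cmod_mult, Hw; lra.
    + set (Qw := peval _ d w) in *; set (Qv := peval _ d v) in *.
      replace (c 0%nat + w * Qw - (c 0%nat + v * Qv))%C
        with ((w - v) * Qw + v * (Qw - Qv))%C by ring.
      eapply Rle_trans; [apply Cmod_triangle|].
      rewrite !Cmod_mult, Hv.
      pose proof (Cmod_ge_0 (w - v)); nra.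
Qed.

(** Telescoping: [(x - 1)] times the sum is [x^(n+1) - 1 = 0]. *)
Lemma geometric_sum_root_of_unity (x : C) (n : nat) :
  Cpow x (S n) = RtoC 1 -> x <> RtoC 1 ->
  sum_n (fun k => Cpow x k) n = RtoC 0.
Proof.
  intros Hx Hx1.
  assert (E : forall m, ((x - 1) * sum_n (fun k => Cpow x k) m
                         = Cpow x (S m) - 1)%C).
  { induction m as [|m IH].
    - rewrite sum_O; simpl; Cring.
    - rewrite sum_Sn; change (plus ?a ?b) with (a + b)%C.
      rewrite Cmult_plus_distr_l, IH, !Cpow_S; Cring. }
  specialize (E n); rewrite Hx in E.
  assert (Hz : (x - 1)%C <> RtoC 0).
  { intros H; apply Hx1.
    replace x with (x - 1 + 1)%C by ring; rewrite H; ring. }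
  set (s := sum_n _ n) in *.
  replace s with (/ (x - 1) * ((x - 1) * s))%C by (field; exact Hz).
  rewrite E; Cring.
Qed.

(** * Parseval's identity over the roots of unity *)

Definition root_of_unity (n k : nat) : C :=
  cis (INR k * (2 * PI / INR (S n))).

(** Exchanging the roles of [j] and [k] makes this the geometric sum of the
    powers of the [j]-th root, which differs from 1 because [0 < j < n + 1]. *)
Lemma sum_root_of_unity_pow (n j : nat) :
  (0 < j <= n)%nat ->
  sum_n (fun k => Cpow (root_of_unity n k) j) n = RtoC 0.
Proof.
  intros Hj.
  pose proof (lt_0_INR (S n) ltac:(lia)) as Hn.
  pose proof (lt_0_INR j ltac:(lia)) as Hj0.
  pose proof (lt_INR j (S n) ltac:(lia)) as Hjn.
  pose proof PI_RGT_0 as Hpi.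
  set (x := cis (INR j * (2 * PI / INR (S n)))).
  rewrite (sum_n_ext _ (fun k => Cpow x k)).
  2:{ intros k; unfold root_of_unity, x; rewrite !cis_pow; f_equal; ring. }
  apply geometric_sum_root_of_unity; unfold x.
  - rewrite cis_pow.
    replace (INR (S n) * (INR j * (2 * PI / INR (S n))))
      with (0 + 2 * INR j * PI) by (field; lra).
    unfold cis; rewrite cos_period, sin_period, cos_0, sin_0; reflexivity.
  - apply cis_neq_1; split.
    + apply Rmult_lt_0_compat; [lra|]; apply Rdiv_lt_0_compat; lra.
    + replace (INR j * (2 * PI / INR (S n)))
        with (2 * PI * (INR j / INR (S n))) by (field; lra).
      rewrite <- (Rmult_1_r (2 * PI)) at 2.
      apply Rmult_lt_compat_l; [lra|].
      apply Rlt_div_l; lra.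
Qed.

Lemma sum_Re (u : nat -> C) (n : nat) :
  sum_n (fun k => Re (u k)) n = Re (sum_n u n).
Proof.
  induction n as [|n IH].
  - rewrite !sum_O; reflexivity.
  - rewrite !sum_Sn, IH; reflexivity.
Qed.

Lemma Cmod2_plus (x y : C) :
  Cmod (x + y) ^ 2 = Cmod x ^ 2 + Cmod y ^ 2 + 2 * Re (Cconj x * y).
Proof.
  rewrite !Cmod2_alt; destruct x as [a b], y as [p q]; simpl; ring.
Qed.

(** By induction on the degree: with [Q w = c_0 + w R w], the cross term in
    [|Q|^2 = |c_0|^2 + |R|^2 + 2 Re (conj c_0 * w R w)] averages to 0, since
    [w R w] only contains powers [w^j] with [0 < j <= n]. *)
Lemma discrete_parseval (c : nat -> C) (d n : nat) :
  (d <= n)%nat ->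
  sum_n (fun k => Cmod (peval c d (root_of_unity n k)) ^ 2) n
  = INR (S n) * sum_n (fun j => Cmod (c j) ^ 2) d.
Proof.
  revert c; induction d as [|d IH]; intros c Hd.
  - rewrite sum_O, <- sum_n_const; apply sum_n_ext; intros k.
    unfold peval; rewrite sum_O; simpl Cpow; rewrite Cmult_1_r; reflexivity.
  - rewrite sum_n_shift; change (plus ?a ?b) with (a + b).
    rewrite Rmult_plus_distr_l, <- IH, <- sum_n_const by lia.
    change Rplus with (@plus R_AbelianMonoid); rewrite <- sum_n_plus.
    change (@plus R_AbelianMonoid) with Rplus.
    set (w := root_of_unity n).
    set (Q := peval (fun j => c (S j)) d).
    rewrite (sum_n_ext _ (fun k => plus
      (Cmod (c 0%nat) ^ 2 + Cmod (Q (w k)) ^ 2)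
      (Re ((2 * Cconj (c 0%nat)) * (w k * Q (w k)))%C))).
    2:{ intros k; rewrite peval_S, Cmod2_plus.
        rewrite (Cmod_mult (w k)).
        replace (Cmod (w k)) with 1 by (symmetry; apply Cmod_cis).
        rewrite Rmult_1_l; change plus with Rplus; f_equal.
        rewrite <- Cmult_assoc, re_scal_l; reflexivity. }
    rewrite sum_n_plus.
    match goal with |- plus ?a ?b = ?c =>
      cut (b = 0); [intros ->; change plus with Rplus; apply Rplus_0_r|] end.
    (* The cross term remains. *)
    rewrite sum_Re.
    rewrite (sum_n_mult_l (K := C_Ring) (2 * Cconj (c 0%nat))%C
               (fun k => w k * Q (w k))%C).
    match goal with |- Re (mult ?a ?b) = _ =>
      cut (b = RtoC 0); [intros ->; change mult with Cmult;
        rewrite Cmult_0_r; reflexivity|] end.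
    rewrite (sum_n_ext _ (fun k =>
      sum_n (fun j => c (S j) * Cpow (w k) (S j))%C d)).
    2:{ intros k; unfold Q, peval.
        rewrite <- (sum_n_mult_l (K := C_Ring)); apply sum_n_ext; intros j.
        rewrite Cpow_S; Cring. }
    rewrite sum_n_switch.
    rewrite (sum_n_ext_loc _ (fun _ => RtoC 0)).
    + generalize d; induction d0 as [|m IHm];
        [apply sum_O | rewrite sum_Sn, IHm; apply Cplus_0_r].
    + intros j Hj; rewrite (sum_n_mult_l (K := C_Ring)).
      unfold w; rewrite sum_root_of_unity_pow by lia.
      apply Cmult_0_r.
Qed.

Lemma sum_n_le (u v : nat -> R) (n : nat) :
  (forall k, u k <= v k) -> sum_n u n <= sum_n v n.
Proof.
  intros H; induction n as [|n IH].
  - rewrite !sum_O; apply H.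
  - rewrite !sum_Sn; apply Rplus_le_compat; auto.
Qed.

(** Bessel's inequality for polynomials: an average is at most the maximum. *)
Lemma sum_coef_sqr_le (c : nat -> C) (d : nat) (B : R) :
  (forall w, Cmod w = 1 -> Cmod (peval c d w) <= B) ->
  sum_n (fun j => Cmod (c j) ^ 2) d <= B ^ 2.
Proof.
  intros HB.
  apply (Rmult_le_reg_l (INR (S d))); [apply lt_0_INR; lia|].
  rewrite <- discrete_parseval, <- sum_n_const by lia.
  apply sum_n_le; intros k.
  apply pow_incr; split; [apply Cmod_ge_0|].
  apply HB, Cmod_cis.
Qed.

(** * Attaining the maximum *)

(** The usual argument with [eps]: [h] at nearby angles [s] and [t] differs by
    two approximation errors plus the variation of one Lipschitz polynomial. *)
Lemma uniform_limit_attains_max (h : C -> R) :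
  (forall eps, 0 < eps -> exists c d, forall w, Cmod w = 1 ->
     Rabs (h w - Cmod (peval c d w)) <= eps) ->
  exists w0, Cmod w0 = 1 /\ forall w, Cmod w = 1 -> h w <= h w0.
Proof.
  intros Hh.
  pose proof PI_RGT_0 as Hpi.
  destruct (continuity_ab_maj (fun t => h (cis t)) (- PI) PI)
    as [t0 [Hmax _]]; [lra| |].
  - intros t _ eps Heps.
    destruct (Hh (eps / 4)) as (c & d & Hcd); [lra|].
    destruct (peval_lipschitz c d) as (B & L & _ & HL & HQ).
    destruct (cis_continuous t (eps / 4 / (L + 1))) as (del & Hdel & Hcis).
    { apply Rdiv_lt_0_compat; lra. }
    exists del; split; [exact Hdel|].
    intros s [_ Hs]; simpl in *; unfold R_dist in *.
    pose proof (Hcd (cis s) (Cmod_cis s)) as A1.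
    pose proof (Hcd (cis t) (Cmod_cis t)) as A2.
    destruct (HQ (cis s) (cis t) (Cmod_cis s) (Cmod_cis t)) as [_ A3].
    destruct (HQ (cis t) (cis s) (Cmod_cis t) (Cmod_cis s)) as [_ A4].
    specialize (Hcis s Hs).
    assert (A5 : L * Cmod (cis s - cis t) <= eps / 4).
    { replace (eps / 4) with ((L + 1) * (eps / 4 / (L + 1))) by (field; lra).
      pose proof (Cmod_ge_0 (cis s - cis t)); nra. }
    replace (cis t - cis s)%C with (- (cis s - cis t))%C in A4 by ring.
    rewrite Cmod_opp in A4.
    set (Qs := peval c d (cis s)) in *; set (Qt := peval c d (cis t)) in *.
    pose proof (Cmod_triangle (Qs - Qt) Qt) as B1.
    pose proof (Cmod_triangle (Qt - Qs) Qs) as B2.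
    replace (Qs - Qt + Qt)%C with Qs in B1 by ring.
    replace (Qt - Qs + Qs)%C with Qt in B2 by ring.
    apply Rabs_le_between in A1; apply Rabs_le_between in A2.
    apply Rabs_def1; lra.
  - exists (cis t0); split; [apply Cmod_cis|].
    intros w Hw; destruct (unit_circle_cis w Hw) as (t & Ht & ->).
    apply Hmax; exact Ht.
Qed.

(** * Windows of a two-sided series *)

(** The window [-(N+1) .. N] has [N+1] indices on either side, so it matches
    the partial sums of the two halves at the same rank [N]. *)
Lemma sum_n_window {G : AbelianMonoid} (u : Z -> G) (N : nat) :
  sum_n (fun j => u (Z.of_nat j - Z.of_nat (S N))%Z) (S (2 * N))
  = plus (sum_n (neg_part u) N) (sum_n (nonneg_part u) N).
Proof.
  induction N as [|N IH].
  - simpl Nat.mul; rewrite sum_Sn, !sum_O; reflexivity.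
  - replace (S (2 * S N)) with (S (S (S (2 * N)))) by lia.
    rewrite sum_Sn, sum_n_shift.
    rewrite (sum_n_ext (fun k => u (Z.of_nat (S k) - Z.of_nat (S (S N)))%Z)
               (fun j => u (Z.of_nat j - Z.of_nat (S N))%Z))
      by (intros k; f_equal; lia).
    rewrite IH, !sum_Sn.
    replace (u (Z.of_nat 0 - Z.of_nat (S (S N)))%Z) with (neg_part u (S N))
      by (unfold neg_part; f_equal; lia).
    replace (u (Z.of_nat (S (S (S (2 * N)))) - Z.of_nat (S (S N)))%Z)
      with (nonneg_part u (S N)) by (unfold nonneg_part; f_equal; lia).
    rewrite (plus_assoc (neg_part u (S N))), (plus_comm (neg_part u (S N))).
    symmetry; apply plus_assoc.
Qed.

Lemma Cpowz_nat (z : C) (n : nat) : Cpowz z (Z.of_nat n) = Cpow z n.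
Proof.
  destruct n as [|n]; [reflexivity|].
  cbn [Cpowz Z.of_nat]; rewrite SuccNat2Pos.id_succ; reflexivity.
Qed.

Lemma Cpowz_opp_nat (z : C) (n : nat) :
  Cpowz z (- Z.of_nat n) = Cinv (Cpow z n).
Proof.
  destruct n as [|n].
  - simpl; field; intros H; apply (f_equal fst) in H; simpl in H; lra.
  - cbn [Cpowz Z.of_nat Z.opp]; rewrite SuccNat2Pos.id_succ; reflexivity.
Qed.

Lemma Z_nat_or_opp (k : Z) :
  exists n : nat, k = Z.of_nat n \/ k = (- Z.of_nat n)%Z.
Proof. exists (Z.abs_nat k); lia. Qed.

Lemma powerRZ_opp_nat (x : R) (n : nat) : powerRZ x (- Z.of_nat n) = / x ^ n.
Proof. rewrite powerRZ_neg', <- pow_powerRZ; reflexivity. Qed.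

Lemma Cmod_laurent_term (a : Z -> C) (z : C) (k : Z) : z <> RtoC 0 ->
  Cmod (laurent_term a z k) = Cmod (a k) * powerRZ (Cmod z) k.
Proof.
  intros Hz; unfold laurent_term; rewrite Cmod_mult; f_equal.
  destruct (Z_nat_or_opp k) as [n [-> | ->]].
  - rewrite Cpowz_nat, Cmod_pow, <- pow_powerRZ; reflexivity.
  - rewrite Cpowz_opp_nat, powerRZ_opp_nat, Cmod_inv by (apply Cpow_nz, Hz).
    rewrite Cmod_pow; reflexivity.
Qed.

(** On the window, [j >= 0] is the exponent after multiplying by [w^n] and
    [j - n] is the exponent in the Laurent series. *)
Lemma Cpowz_clear_denominator (r : R) (w : C) (n j : nat) :
  r <> 0 -> w <> RtoC 0 ->
  (Cpow w n * Cpowz (RtoC r * w) (Z.of_nat j - Z.of_nat n)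
   = RtoC (powerRZ r (Z.of_nat j - Z.of_nat n)) * Cpow w j)%C.
Proof.
  intros Hr Hw.
  assert (Hr' : RtoC r <> RtoC 0) by (intros H; apply Hr, RtoC_inj, H).
  destruct (le_lt_dec n j) as [H | H].
  - replace (Z.of_nat j - Z.of_nat n)%Z with (Z.of_nat (j - n)) by lia.
    rewrite Cpowz_nat, <- pow_powerRZ, RtoC_pow, Cpow_mult_l.
    replace (Cpow w j) with (Cpow w n * Cpow w (j - n))%C
      by (rewrite <- Cpow_add_r; f_equal; lia).
    ring.
  - replace (Z.of_nat j - Z.of_nat n)%Z with (- Z.of_nat (n - j))%Z by lia.
    rewrite Cpowz_opp_nat, powerRZ_opp_nat, RtoC_inv by (apply pow_nonzero, Hr).
    rewrite RtoC_pow, Cpow_mult_l.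
    replace (Cpow w n) with (Cpow w j * Cpow w (n - j))%C
      by (rewrite <- Cpow_add_r; f_equal; lia).
    field.
    split; apply Cpow_nz; assumption.
Qed.

(** Coefficients of [w^(N+1)] times the window sum of the Laurent series at
    [r w], as a polynomial in [w]. *)
Definition laurent_coef (a : Z -> C) (r : R) (N j : nat) : C :=
  let k := (Z.of_nat j - Z.of_nat (S N))%Z in (a k * RtoC (powerRZ r k))%C.

Lemma peval_laurent_coef (a : Z -> C) (r : R) (N : nat) (w : C) :
  r <> 0 -> w <> RtoC 0 ->
  peval (laurent_coef a r N) (S (2 * N)) w
  = (Cpow w (S N) *
     (sum_n (neg_part (laurent_term a (RtoC r * w))) N
      + sum_n (nonneg_part (laurent_term a (RtoC r * w))) N))%C.
Proof.
  intros Hr Hw.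
  change Cplus with (@plus C_AbelianMonoid).
  rewrite <- (sum_n_window (G := C_AbelianMonoid)).
  change Cmult with (@mult C_Ring) at 2.
  rewrite <- (sum_n_mult_l (K := C_Ring)).
  unfold peval; apply sum_n_ext; intros j.
  change (@mult C_Ring) with Cmult; unfold laurent_coef, laurent_term.
  rewrite <- Cmult_assoc, <- Cpowz_clear_denominator by assumption; Cring.
Qed.

(** * Geometric decay and uniform tails *)

Lemma ex_series_bounded {K : AbsRing} {V : NormedModule K} (u : nat -> V) :
  ex_series u -> exists M, forall n, norm (u n) <= M.
Proof.
  intros [l Hl].
  destruct (filterlim_bounded (sum_n u)) as [M HM]; [exists l; exact Hl|].
  exists (M + M); intros [|n].
  - pose proof (HM 0%nat) as H0; rewrite sum_O in H0.
    pose proof (norm_ge_0 (u 0%nat)); lra.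
  - replace (u (S n)) with (minus (sum_n u (S n)) (sum_n u n)).
    + eapply Rle_trans; [apply norm_triangle|].
      rewrite norm_opp; apply Rplus_le_compat; apply HM.
    + rewrite sum_Sn; unfold minus.
      rewrite (plus_comm (sum_n u n)), <- plus_assoc.
      transitivity (plus (u (S n)) zero); [|apply plus_zero_r].
      f_equal; apply (plus_opp_r (G := V)).
Qed.

(** Multiplied by [1 - q], the estimate telescopes and can be proved by
    induction on the number [p] of terms. *)
Lemma geometric_partial_tail (u : nat -> C) (K q : R) (N p : nat) :
  0 <= q < 1 -> (forall n, Cmod (u n) <= K * q ^ n) ->
  (1 - q) * Cmod (sum_n u (N + p) - sum_n u N)
  <= K * (q ^ S N - q ^ S (N + p)).
Proof.
  intros Hq Hu; induction p as [|p IH].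
  - rewrite Nat.add_0_r.
    replace (sum_n u N - sum_n u N)%C with (RtoC 0) by Cring.
    rewrite Cmod_0; lra.
  - rewrite Nat.add_succ_r, sum_Sn; change (plus ?x ?y) with (x + y)%C.
    replace (sum_n u (N + p) + u (S (N + p)) - sum_n u N)%C
      with ((sum_n u (N + p) - sum_n u N) + u (S (N + p)))%C by Cring.
    pose proof (Cmod_triangle (sum_n u (N + p) - sum_n u N) (u (S (N + p)))).
    pose proof (Hu (S (N + p))).
    change (q ^ S (S (N + p))) with (q * q ^ S (N + p)).
    nra.
Qed.

Lemma geometric_tail (u : nat -> C_NormedModule) (l : C_NormedModule)
    (K q : R) (N : nat) :
  0 <= q < 1 -> (forall n, Cmod (u n) <= K * q ^ n) -> is_series u l ->
  Cmod (l - sum_n u N)%C <= K / (1 - q) * q ^ S N.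
Proof.
  intros Hq Hu Hl.
  apply le_epsilon; intros eps Heps.
  destruct (proj1 (filterlim_locally_ball_norm _ _) Hl (mkposreal eps Heps))
    as [m Hm].
  specialize (Hm (N + m)%nat ltac:(lia)); unfold ball_norm in Hm; simpl in Hm.
  change (Cmod (sum_n u (N + m) - l) < eps) in Hm.
  pose proof (geometric_partial_tail u K q N m Hq Hu) as Ht.
  assert (HK : 0 <= K).
  { pose proof (Cmod_ge_0 (u 0%nat)); specialize (Hu 0%nat); simpl in Hu; lra. }
  pose proof (pow_le q (S (N + m)) (proj1 Hq)).
  assert (Ht' : Cmod (sum_n u (N + m) - sum_n u N)%C <= K / (1 - q) * q ^ S N).
  { apply (Rmult_le_reg_l (1 - q)); [lra|].
    replace ((1 - q) * (K / (1 - q) * q ^ S N)) with (K * q ^ S N)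
      by (field; lra).
    eapply Rle_trans; [exact Ht|].
    apply Rmult_le_compat_l; lra. }
  replace (l - sum_n u N)%C with
    ((sum_n u (N + m) - sum_n u N) + - (sum_n u (N + m) - l))%C by Cring.
  eapply Rle_trans; [apply Cmod_triangle|]; rewrite Cmod_opp; lra.
Qed.

(** The modulus of the [k]-th Laurent term anywhere on the circle of radius
    [r]. *)
Definition laurent_weight (a : Z -> C) (r : R) (k : Z) : R :=
  Cmod (a k) * powerRZ r k.

(** The terms on the larger circle [|z| = rho] are bounded, and passing to
    radius [r] gains a factor [(r / rho)^n]. *)
Lemma nonneg_weight_geometric (a : Z -> C) (r rho : R) :
  0 < r -> r < rho -> ex_series (nonneg_part (laurent_term a (RtoC rho))) ->
  exists K, forall n, nonneg_part (laurent_weight a r) n <= K * (r / rho) ^ n.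
Proof.
  intros Hr Hrho Hs.
  destruct (ex_series_bounded _ Hs) as [M HM]; exists M; intros n.
  specialize (HM n); unfold nonneg_part in *.
  change (norm ?x) with (Cmod x) in HM.
  rewrite Cmod_laurent_term, Cmod_R, Rabs_pos_eq in HM; [|lra|].
  2:{ intros H; apply RtoC_inj in H; lra. }
  unfold laurent_weight; rewrite <- pow_powerRZ in *.
  pose proof (pow_lt rho n ltac:(lra)); pose proof (pow_lt r n Hr).
  unfold Rdiv; rewrite Rpow_mult_distr, pow_inv.
  replace (Cmod (a (Z.of_nat n)) * r ^ n)
    with (Cmod (a (Z.of_nat n)) * rho ^ n * (r ^ n * / rho ^ n))
    by (field; lra).
  apply Rmult_le_compat_r; [|exact HM].
  apply Rlt_le, Rmult_lt_0_compat; [|apply Rinv_0_lt_compat]; assumption.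
Qed.

Lemma neg_weight_geometric (a : Z -> C) (r rho : R) :
  0 < rho -> rho < r -> ex_series (neg_part (laurent_term a (RtoC rho))) ->
  exists K, forall n, neg_part (laurent_weight a r) n <= K * (rho / r) ^ n.
Proof.
  intros Hrho Hr Hs.
  destruct (ex_series_bounded _ Hs) as [M HM].
  (* The index is [-(n+1)], which gains [(rho / r)^(n+1)]: one factor goes into
     the constant. *)
  exists (M * (rho / r)); intros n.
  specialize (HM n); unfold neg_part in *.
  change (norm ?x) with (Cmod x) in HM.
  rewrite Cmod_laurent_term, Cmod_R, Rabs_pos_eq in HM; [|lra|].
  2:{ intros H; apply RtoC_inj in H; lra. }
  unfold laurent_weight; rewrite powerRZ_opp_nat in *.
  pose proof (pow_lt rho (S n) Hrho); pose proof (pow_lt r (S n) ltac:(lra)).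
  rewrite Rmult_assoc; change (rho / r * (rho / r) ^ n) with ((rho / r) ^ S n).
  unfold Rdiv; rewrite Rpow_mult_distr, pow_inv.
  set (A := Cmod _) in *.
  replace (A * / r ^ S n)
    with (A * / rho ^ S n * (rho ^ S n * / r ^ S n)) by (field; lra).
  apply Rmult_le_compat_r; [|exact HM].
  apply Rlt_le, Rmult_lt_0_compat; [|apply Rinv_0_lt_compat]; assumption.
Qed.

Lemma Rbar_lt_between (x : R) (y : Rbar) :
  Rbar_lt x y -> exists z : R, x < z /\ Rbar_lt z y.
Proof.
  destruct y as [y| |]; simpl; intros H.
  - exists ((x + y) / 2); lra.
  - exists (x + 1); split; [lra | exact I].
  - destruct H.
Qed.

Lemma geometric_le (K1 K2 q1 q2 x : R) (n : nat) :
  0 <= q1 <= q2 -> K1 <= K2 -> 0 <= K2 -> x <= K1 * q1 ^ n -> x <= K2 * q2 ^ n.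
Proof.
  intros Hq HK HK2 Hx.
  pose proof (pow_incr q1 q2 n Hq); pose proof (pow_le q1 n (proj1 Hq)); nra.
Qed.

(** One constant and one ratio serve both halves: the larger ratio, and the sum
    of the absolute values of the constants. *)
Lemma laurent_weight_geometric (r1 : R) (r2 : Rbar) (a : Z -> C) (f : C -> C)
    (r : R) :
  0 <= r1 -> is_laurent_series a r1 r2 f -> r1 < r -> Rbar_lt r r2 ->
  exists K q, 0 <= q < 1 /\
    (forall n, nonneg_part (laurent_weight a r) n <= K * q ^ n) /\
    (forall n, neg_part (laurent_weight a r) n <= K * q ^ n).
Proof.
  intros Hr1 (Hpos & Hneg & _) Hr Hr2.
  destruct (Rbar_lt_between r r2 Hr2) as (rho & Hrho & Hrho2).
  set (sig := (r1 + r) / 2).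
  assert (Hsig : r1 < sig < r) by (unfold sig; lra).
  destruct (nonneg_weight_geometric a r rho) as [K1 HK1]; [lra|lra| |].
  { apply Hpos; rewrite Cmod_R, Rabs_pos_eq by lra; exact Hrho2. }
  destruct (neg_weight_geometric a r sig) as [K2 HK2]; [lra|lra| |].
  { apply Hneg; rewrite Cmod_R, Rabs_pos_eq by lra; lra. }
  assert (Hq1 : 0 <= r / rho < 1).
  { split; [apply Rlt_le, Rdiv_lt_0_compat; lra | apply Rlt_div_l; lra]. }
  assert (Hq2 : 0 <= sig / r < 1).
  { split; [apply Rlt_le, Rdiv_lt_0_compat; lra | apply Rlt_div_l; lra]. }
  pose proof (Rmax_l (r / rho) (sig / r)); pose proof (Rmax_r (r / rho) (sig / r)).
  pose proof (Rabs_pos K1); pose proof (Rabs_pos K2).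
  pose proof (Rle_abs K1); pose proof (Rle_abs K2).
  exists (Rabs K1 + Rabs K2), (Rmax (r / rho) (sig / r)).
  split; [split; [lra | apply Rmax_lub_lt; lra]|].
  split; intros n.
  - apply (geometric_le K1 _ (r / rho)); [lra|lra|lra|apply HK1].
  - apply (geometric_le K2 _ (sig / r)); [lra|lra|lra|apply HK2].
Qed.

(** The error does not depend on [w]: the terms of the series at [r w] have
    moduli [laurent_weight a r k], so each half has a geometric tail. *)
Lemma laurent_approx (r1 : R) (r2 : Rbar) (a : Z -> C) (f : C -> C)
    (r K q : R) (N : nat) (w : C) :
  is_laurent_series a r1 r2 f -> 0 < r -> r1 < r -> Rbar_lt r r2 ->
  0 <= q < 1 ->
  (forall n, nonneg_part (laurent_weight a r) n <= K * q ^ n) ->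
  (forall n, neg_part (laurent_weight a r) n <= K * q ^ n) ->
  Cmod w = 1 ->
  Rabs (Cmod (f (RtoC r * w)%C)
        - Cmod (peval (laurent_coef a r N) (S (2 * N)) w))
  <= 2 * K / (1 - q) * q ^ S N.
Proof.
  intros (_ & _ & Hf) Hr0 Hr Hr2 Hq Hpos Hneg Hw.
  assert (Hw0 : w <> RtoC 0) by (apply Cmod_gt_0; lra).
  set (z := (RtoC r * w)%C).
  assert (Hz : Cmod z = r).
  { unfold z; rewrite Cmod_mult, Cmod_R, Rabs_pos_eq, Hw by lra; ring. }
  assert (Hz0 : z <> RtoC 0) by (apply Cmod_gt_0; lra).
  assert (Hterm : forall k, Cmod (laurent_term a z k) = laurent_weight a r k).
  { intros k; rewrite Cmod_laurent_term, Hz by exact Hz0; reflexivity. }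
  destruct (Hf z) as (p & s & Hp & Hs & Hsum); [rewrite Hz; exact Hr |
    rewrite Hz; exact Hr2 |].
  rewrite peval_laurent_coef, Cmod_mult, Cmod_pow, Hw, pow1, Rmult_1_l
    by (assumption || lra).
  fold z; rewrite Hsum; change (plus p s) with (p + s)%C.
  assert (Tp := geometric_tail _ p K q N Hq
    (fun n => Rle_trans _ _ _ (Req_le _ _ (Hterm _)) (Hneg n)) Hp).
  assert (Ts := geometric_tail _ s K q N Hq
    (fun n => Rle_trans _ _ _ (Req_le _ _ (Hterm _)) (Hpos n)) Hs).
  set (P := sum_n (neg_part _) N) in *; set (Q := sum_n (nonneg_part _) N) in *.
  assert (T : Cmod ((p + s) - (P + Q))%C <= 2 * K / (1 - q) * q ^ S N).
  { replace ((p + s) - (P + Q))%C with ((p - P) + (s - Q))%C by Cring.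
    eapply Rle_trans; [apply Cmod_triangle|].
    replace (2 * K / (1 - q) * q ^ S N)
      with (K / (1 - q) * q ^ S N + K / (1 - q) * q ^ S N) by (field; lra).
    apply Rplus_le_compat; assumption. }
  eapply Rle_trans; [|exact T].
  apply (norm_triangle_inv (V := C_NormedModule)).
Qed.

Lemma geometric_lim_0 (E q : R) : 0 <= q < 1 ->
  is_lim_seq (fun n => E * q ^ S n) 0.
Proof.
  intros Hq.
  replace (Finite 0) with (Rbar_mult E 0) by (simpl; f_equal; ring).
  apply is_lim_seq_scal_l.
  apply (is_lim_seq_incr_1 (fun n => q ^ n)), is_lim_seq_geom.
  rewrite Rabs_pos_eq; lra.
Qed.

Lemma ex_series_geometric_sqr (u : nat -> R) (K q : R) :
  0 <= q < 1 -> (forall n, 0 <= u n <= K * q ^ n) ->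
  ex_series (V := R_NormedModule) (fun n => u n ^ 2).
Proof.
  intros Hq Hu.
  apply (ex_series_le (V := R_CompleteNormedModule) _
    (fun n => K ^ 2 * (q ^ 2) ^ n)).
  - intros n; change (norm (u n ^ 2)) with (Rabs (u n ^ 2)).
    rewrite Rabs_pos_eq by apply pow2_ge_0.
    rewrite <- pow_mult, Nat.mul_comm, pow_mult, <- Rpow_mult_distr.
    apply pow_incr, Hu.
  - apply (ex_series_scal (V := R_NormedModule) (K ^ 2)), ex_series_geom.
    rewrite Rabs_pos_eq; nra.
Qed.

(** * The inequality *)

Theorem theorem13p1 (r1 : R) (r2 : Rbar) (a : Z -> C) (f : C -> C) (r : R)
    (hr1 : 0 <= r1) (hr12 : Rbar_lt r1 r2)
    (hf : is_laurent_series a r1 r2 f)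
    (hr : r1 < r) (hr2 : Rbar_lt r r2) :
  exists M S : R,
    is_max_modulus f r M /\
    is_series_Z (V := R_NormedModule)
      (fun j : Z => Cmod (a j) ^ 2 * powerRZ r (2 * j)) S /\
    S <= M ^ 2.
Proof.
  destruct (laurent_weight_geometric r1 r2 a f r hr1 hf hr hr2)
    as (K & q & Hq & Hpos & Hneg).
  assert (Hr0 : 0 < r) by lra.
  pose proof (fun N w => laurent_approx r1 r2 a f r K q N w
                hf Hr0 hr hr2 Hq Hpos Hneg) as Happ.
  set (E := 2 * K / (1 - q)) in *.
  pose proof (geometric_lim_0 E q Hq) as HE.
  destruct (uniform_limit_attains_max (fun w => Cmod (f (RtoC r * w)%C)))
    as (w0 & Hw0 & Hmax).
  { intros eps Heps.
    destruct (proj2 (is_lim_seq_spec _ _) HE (mkposreal eps Heps)) as [N HN].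
    exists (laurent_coef a r N), (S (2 * N)); intros w Hw.
    eapply Rle_trans; [apply Happ, Hw|].
    specialize (HN N (le_n N)); cbn [pos] in HN.
    apply Rabs_lt_between in HN; lra. }
  set (M := Cmod (f (RtoC r * w0)%C)) in *.
  assert (Hw_nonneg : forall k, 0 <= laurent_weight a r k).
  { intros k; apply Rmult_le_pos; [apply Cmod_ge_0 | apply powerRZ_le, Hr0]. }
  set (g := fun j : Z => Cmod (a j) ^ 2 * powerRZ r (2 * j)).
  assert (Hg : forall k, laurent_weight a r k ^ 2 = g k).
  { intros k; unfold laurent_weight, g.
    rewrite <- Z.add_diag, powerRZ_add by lra; ring. }
  assert (Sneg : ex_series (V := R_NormedModule) (neg_part g)).
  { apply (ex_series_ext (fun n => neg_part (laurent_weight a r) n ^ 2)).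
    - intros n; apply Hg.
    - apply (ex_series_geometric_sqr _ K q Hq).
      intros n; split; [apply Hw_nonneg | apply Hneg]. }
  assert (Spos : ex_series (V := R_NormedModule) (nonneg_part g)).
  { apply (ex_series_ext (fun n => nonneg_part (laurent_weight a r) n ^ 2)).
    - intros n; apply Hg.
    - apply (ex_series_geometric_sqr _ K q Hq).
      intros n; split; [apply Hw_nonneg | apply Hpos]. }
  destruct Sneg as [p Hp], Spos as [s Hs].
  exists M, (p + s); split; [|split].
  - split.
    + exists (RtoC r * w0)%C; split; [|reflexivity].
      rewrite Cmod_mult, Cmod_R, Rabs_pos_eq, Hw0 by lra; ring.
    + intros z Hz.
      assert (Hr' : RtoC r <> RtoC 0) by (intros H; apply RtoC_inj in H; lra).
      replace z with (RtoC r * (z / RtoC r))%C by (field; exact Hr').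
      apply Hmax.
      rewrite Cmod_div, Cmod_R, Rabs_pos_eq, Hz by (exact Hr' || lra).
      field; lra.
  - exists p, s; split; [exact Hp | split; [exact Hs | reflexivity]].
  - apply (is_lim_seq_le
      (fun N => sum_n (neg_part g) N + sum_n (nonneg_part g) N)
      (fun N => (M + E * q ^ S N) ^ 2) (p + s) (M ^ 2)).
    + (* Bessel's inequality for the polynomial of rank [N]. *)
      intros N.
      change Rplus with (@plus R_AbelianMonoid) at 1.
      rewrite <- (sum_n_window (G := R_AbelianMonoid)).
      rewrite (sum_n_ext _ (fun j => Cmod (laurent_coef a r N j) ^ 2)).
      2:{ intros j; rewrite <- Hg; unfold laurent_coef, laurent_weight.
          rewrite Cmod_mult, Cmod_R, Rabs_pos_eq by (apply powerRZ_le, Hr0).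
          reflexivity. }
      apply sum_coef_sqr_le; intros w Hw.
      specialize (Happ N w Hw); specialize (Hmax w Hw).
      apply Rabs_le_between in Happ; lra.
    + apply is_lim_seq_plus'; assumption.
    + replace (M ^ 2) with ((M + 0) * ((M + 0) * 1)) by ring.
      repeat apply is_lim_seq_mult'; try apply is_lim_seq_const;
        apply is_lim_seq_plus'; try apply is_lim_seq_const; exact HE.
Qed.
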